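(* Let $R>0$, $\beta>0$, $C_0\ge1$ and $A\ge0$. Let $E:(0,R]\to[0,\infty)$ be a function satisfying $$E(s)\le C_0\left(\frac sr\right)^\beta E(r)+A\,r^\beta\qquad\text{for all }0<s<r\le R.$$ Let $B>0$ be chosen so that $$C_0e^{-B}<1\qquad\text{and}\qquad B>2\beta.$$ Then there exists a constant $C$, depending only on $C_0,\beta,B$, such that $$E(s)\le C\left(\frac{E(R)}{R^\beta}+A\right)s^\beta\exp\left(B\sqrt{1+\log\frac Rs}\right)$$ for every $0<s\le R$. *)

(* Defs.v *)
From Stdlib Require Export Reals.

Open Scope R_scope.

(* Growth condition on (0, Rad].  Real powers are [Rpower], which is the usual
   x^y for x > 0; it is only applied here to positive bases.  [E] is a total
   function whose values outside (0, Rad] are irrelevant. *)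
Definition growth_condition (C0 beta A Rad : R) (E : R -> R) : Prop :=
  forall s r : R, 0 < s -> s < r -> r <= Rad ->
    E s <= C0 * Rpower (s / r) beta * E r + A * Rpower r beta.

(* Main.v *)
Require Import Defs.
From Stdlib Require Import Reals Lra.
Open Scope R_scope.

(** Substitute [s = Rad * exp (1 - x^2)], that is [x = sqrt (1 + ln (Rad / s))],
    and divide [E] by the [beta]-th power of its argument.  The growth condition
    becomes [F x <= C0 * F y + A * exp (beta * (x^2 - y^2))] for [1 <= y < x]
    ([growth_in_sqrt_log_scale]), and the claim becomes
    [F x <= C * (F 1 + A) * exp (B * x)].

    Comparing scales at a fixed ratio would lose a factor [C0] per unit of
    logarithm, hence a power of [s].  In the variable [x] the comparison is made
    between [x] and [x - 1], so the ratio of scales grows with depth and only about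
    [sqrt (ln (Rad / s))] factors [C0] are lost; each is absorbed because
    [C0 * exp (- B) < 1].  The price of the longer jump is the inhomogeneous
    term [A * exp (beta * (2 * x - 1))], which [exp (B * x)] dominates because
    [B > 2 * beta].  Induction on the number of unit steps down to [1, 2] gives
    the bound ([exponential_bound_of_quadratic_growth]). *)

(** The constant collects the cost of a single direct comparison with [x = 1]
    when [x <= 2], where [x^2 - 1 <= 3], and the sum of the geometric series of
    ratio [C0 * exp (- B)], which bounds the total of all inhomogeneous terms
    relative to [exp (B * x)]. *)
Definition bound_constant (C0 beta B : R) : R :=
  C0 + exp (3 * beta) + / (1 - C0 * exp (- B)).

Lemma exp_le_compat (x y : R) : x <= y -> exp x <= exp y.
Proof. intros [H | ->]; [left; now apply exp_increasing | lra]. Qed.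

(** A unit step multiplies the majorant [exp (B * x)] by [exp (- B)], so the
    constant reproduces itself as soon as [1 + C0 * exp (- B) * C <= C]. *)
Lemma exponential_bound_of_quadratic_growth (C0 beta B A : R) (F : R -> R) :
  1 <= C0 -> 0 < beta -> C0 * exp (- B) < 1 -> 2 * beta <= B -> 0 <= A ->
  0 <= F 1 ->
  (forall x y, 1 <= y -> y < x ->
     F x <= C0 * F y + A * exp (beta * (x * x - y * y))) ->
  forall x, 1 <= x ->
    F x <= bound_constant C0 beta B * (F 1 + A) * exp (B * x).
Proof.
intros hC0 hbeta hK hB hA hF1 hF.
set (C := bound_constant C0 beta B); set (M := F 1 + A).
assert (hinv : 0 < / (1 - C0 * exp (- B))) by (apply Rinv_0_lt_compat; lra).
pose proof (exp_pos (3 * beta)) as h3.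
assert (hCbase : C0 + exp (3 * beta) <= C) by (unfold C, bound_constant; lra).
assert (hCstep : 1 + C0 * exp (- B) * C <= C).
{ assert (1 <= C * (1 - C0 * exp (- B))); [| lra].
  unfold C, bound_constant; rewrite Rmult_plus_distr_r, Rinv_l by lra.
  assert (0 <= (C0 + exp (3 * beta)) * (1 - C0 * exp (- B)))
    by (apply Rmult_le_pos; lra).
  lra. }
assert (hM : 0 <= M) by (unfold M; lra).
assert (hind : forall n x, 1 <= x -> x <= INR n + 2 -> F x <= C * M * exp (B * x)).
{ induction n as [| n IH]; intros x h1 hx.
  - simpl in hx.
    assert (hCM : F x <= C * M).
    { apply Rle_trans with ((C0 + exp (3 * beta)) * M);
        [| apply Rmult_le_compat_r; assumption].
      assert (hC0M : C0 * F 1 + exp (3 * beta) * A <= (C0 + exp (3 * beta)) * M)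
        by (unfold M; nra).
      destruct h1 as [h1 | <-]; [| nra].
      pose proof (hF x 1 (Rle_refl 1) h1) as h.
      assert (hx2 : x * x - 1 * 1 <= 3) by nra.
      assert (exp (beta * (x * x - 1 * 1)) <= exp (3 * beta))
        by (apply exp_le_compat; nra).
      nra. }
    assert (1 <= exp (B * x)) by (rewrite <- exp_0; apply exp_le_compat; nra).
    assert (0 <= C * M) by (apply Rmult_le_pos; lra).
    nra.
  - rewrite S_INR in hx.
    destruct (Rle_lt_dec x (INR n + 2)) as [hn | hn]; [now apply IH |].
    pose proof (pos_INR n) as hn0.
    pose proof (IH (x - 1) ltac:(lra) ltac:(lra)) as hIH.
    pose proof (hF x (x - 1) ltac:(lra) ltac:(lra)) as h.
    replace (B * (x - 1)) with (- B + B * x) in hIH by ring.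
    rewrite exp_plus in hIH.
    assert (hE : exp (beta * (x * x - (x - 1) * (x - 1))) <= exp (B * x))
      by (apply exp_le_compat; nra).
    apply Rle_trans with ((1 + C0 * exp (- B) * C) * (M * exp (B * x))).
    + assert (hAM : A <= M) by (unfold M; lra).
      pose proof (exp_pos (B * x)) as hpos.
      apply (Rmult_le_compat_l C0) in hIH; [| lra].
      apply (Rmult_le_compat_l A) in hE; [| lra].
      apply (Rmult_le_compat_r (exp (B * x))) in hAM; lra.
    + rewrite (Rmult_assoc C); apply Rmult_le_compat_r; [| exact hCstep].
      apply Rmult_le_pos; [exact hM | left; apply exp_pos]. }
intros x h1.
destruct (INR_unbounded x) as [n hn].
apply (hind n); lra.
Qed.

(** The radius whose square-root logarithmic depth below [Rad] is [x]; the shift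
    by one puts [Rad] itself at [x = 1]. *)
Definition radius_at (Rad x : R) : R := Rad * exp (1 - x * x).

Lemma radius_at_pos (Rad x : R) : 0 < Rad -> 0 < radius_at Rad x.
Proof. intros; apply Rmult_lt_0_compat; [assumption | apply exp_pos]. Qed.

Lemma radius_at_1 (Rad : R) : radius_at Rad 1 = Rad.
Proof.
unfold radius_at; replace (1 - 1 * 1) with 0 by ring.
rewrite exp_0; ring.
Qed.

Lemma radius_at_sqrt_log (Rad s : R) : 0 < s -> s <= Rad ->
  1 <= sqrt (1 + ln (Rad / s)) /\
  radius_at Rad (sqrt (1 + ln (Rad / s))) = s.
Proof.
intros hs hR.
assert (hq : 0 < Rad / s) by (apply Rdiv_lt_0_compat; lra).
assert (hln : 0 <= ln (Rad / s)).
{ destruct hR as [hlt | ->].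
  - rewrite <- ln_1; left; apply ln_increasing; [lra |].
    apply (Rmult_lt_reg_r s); [assumption |].
    unfold Rdiv; rewrite Rmult_assoc, Rinv_l by lra; lra.
  - unfold Rdiv; rewrite Rinv_r, ln_1 by lra; lra. }
split.
- rewrite <- sqrt_1 at 1; apply sqrt_le_1_alt; lra.
- unfold radius_at; rewrite sqrt_sqrt by lra.
  replace (1 - (1 + ln (Rad / s))) with (- ln (Rad / s)) by ring.
  rewrite exp_Ropp, exp_ln by assumption.
  field; lra.
Qed.

Lemma Rpower_radius_at_ratio (Rad beta x y : R) : 0 < Rad ->
  Rpower (radius_at Rad y) beta
  = Rpower (radius_at Rad x) beta * exp (beta * (x * x - y * y)).
Proof.
intros hR.
unfold Rpower, radius_at; rewrite <- exp_plus.
rewrite !ln_mult, !ln_exp by (assumption || apply exp_pos).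
f_equal; ring.
Qed.

Lemma growth_in_sqrt_log_scale (C0 beta A Rad : R) (E : R -> R) :
  0 < Rad -> growth_condition C0 beta A Rad E ->
  let F x := E (radius_at Rad x) / Rpower (radius_at Rad x) beta in
  forall x y, 1 <= y -> y < x ->
    F x <= C0 * F y + A * exp (beta * (x * x - y * y)).
Proof.
intros hR hE F x y hy hxy; unfold F.
assert (hpx := radius_at_pos Rad x hR); assert (hpy := radius_at_pos Rad y hR).
assert (hlt : radius_at Rad x < radius_at Rad y)
  by (apply Rmult_lt_compat_l; [assumption | apply exp_increasing; nra]).
assert (hle : radius_at Rad y <= Rad).
{ rewrite <- (radius_at_1 Rad) at 2.
  apply Rmult_le_compat_l; [lra | apply exp_le_compat; nra]. }
pose proof (hE _ _ hpx hlt hle) as h.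
assert (hdiv : Rpower (radius_at Rad x / radius_at Rad y) beta
               = Rpower (radius_at Rad x) beta / Rpower (radius_at Rad y) beta).
{ unfold Rpower, Rdiv at 2; rewrite <- exp_Ropp, <- exp_plus.
  unfold Rdiv; rewrite ln_mult, ln_Rinv by (auto; now apply Rinv_0_lt_compat).
  f_equal; ring. }
rewrite hdiv in h.
assert (hPx : 0 < Rpower (radius_at Rad x) beta) by apply exp_pos.
assert (hPy : 0 < Rpower (radius_at Rad y) beta) by apply exp_pos.
apply (Rmult_le_reg_r (Rpower (radius_at Rad x) beta)); [assumption |].
apply Rle_trans with (E (radius_at Rad x)); [right; field; lra |].
apply (Rle_trans _ _ _ h).
rewrite (Rpower_radius_at_ratio Rad beta x y hR) at 2.
right; field; lra.
Qed.

Theorem theorem6p2 :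
  forall C0 beta B : R,
    1 <= C0 -> 0 < beta -> 0 < B ->
    C0 * exp (- B) < 1 -> B > 2 * beta ->
    exists C : R,
      forall (Rad A : R) (E : R -> R),
        0 < Rad -> 0 <= A ->
        (forall r : R, 0 < r -> r <= Rad -> 0 <= E r) ->
        growth_condition C0 beta A Rad E ->
        forall s : R, 0 < s -> s <= Rad ->
          E s <= C * (E Rad / Rpower Rad beta + A) * Rpower s beta
                 * exp (B * sqrt (1 + ln (Rad / s))).
Proof.
intros C0 beta B hC0 hbeta _ hK hB.
exists (bound_constant C0 beta B).
intros Rad A E hR hA hE0 hE s hs hsR.
destruct (radius_at_sqrt_log Rad s hs hsR) as [hx1 hxs].
assert (hF1 : 0 <= E (radius_at Rad 1) / Rpower (radius_at Rad 1) beta).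
{ rewrite radius_at_1; apply Rle_mult_inv_pos; [apply hE0; lra | apply exp_pos]. }
pose proof (exponential_bound_of_quadratic_growth C0 beta B A
  (fun x => E (radius_at Rad x) / Rpower (radius_at Rad x) beta)
  hC0 hbeta hK ltac:(lra) hA hF1
  (growth_in_sqrt_log_scale C0 beta A Rad E hR hE) _ hx1) as h.
cbv beta in h; rewrite hxs, radius_at_1 in h.
assert (hP : 0 < Rpower s beta) by apply exp_pos.
apply (Rmult_le_compat_r (Rpower s beta)) in h; [| lra].
replace (E s / Rpower s beta * Rpower s beta) with (E s) in h by (field; lra).
lra.
Qed.
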